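(* Let $p$ and $q$ be two odd prime numbers with $p < q$. Then the Sombor index of the total graph $T_\Gamma(\mathbb{Z}_{pq})$ is $$SO(T_\Gamma(\mathbb{Z}_{pq})) = \sqrt{2}\,\alpha\,(pq-\phi(pq)-1) + \beta\sqrt{(pq-\phi(pq)-1)^2+(pq-\phi(pq))^2} + \sqrt{2}\,(|E|-\alpha-\beta)(pq-\phi(pq)),$$ where $$\alpha = \frac{p(p-1)+q(q-1)}{2},\qquad \beta = 2(p-1)(q-1),\qquad |E| = \frac{(pq-1)(p+q-1)}{2}.$$
   Context: For a finite simple graph $G$, the Sombor index is $SO(G)=\sum_{uv\in E(G)}\sqrt{d_u^2+d_v^2}$, the sum being over (unordered) edges, where $d_x$ is the degree of the vertex $x$. For a commutative ring $R$ with unity, $Z(R)$ denotes the set of zero-divisors of $R$, including $0$. The total graph $T_\Gamma(R)$ is the simple graph whose vertices are all elements of $R$, with distinct vertices $x,y$ adjacent if and only if $x+y\in Z(R)$. $\mathbb{Z}_n$ is the ring of integers modulo $n$ and $\phi$ is Euler's totient function. *)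

(* Defs.v *)
From HB Require Import structures.
From mathcomp Require Import all_boot all_order all_algebra.
From mathcomp Require Import reals.

Set Implicit Arguments.
Unset Strict Implicit.
Unset Printing Implicit Defensive.

Import Order.TTheory GRing.Theory Num.Theory.
Local Open Scope ring_scope.

Record sgraph := SGraph {
  vertex :> finType;
  adj : rel vertex;
  adj_sym : symmetric adj;
  adj_irr : irreflexive adj
}.

Definition edges (G : sgraph) : {set {set G}} :=
  [set [set x; y] | x in G, y in G & adj x y].

Definition degree (G : sgraph) (x : G) : nat := #|[set y : G | adj x y]|.

(* An edge e is the two-element set of its endpoints u and v, so the inner sum
   over x \in e is d_u ^+ 2 + d_v ^+ 2. *)
Definition sombor (R : rcfType) (G : sgraph) : R :=
  \sum_(e in edges G) Num.sqrt (\sum_(x in e) (degree x)%:R ^+ 2).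

(* 0 is a zero-divisor here: A is nontrivial, so y := 1 is a witness. *)
Definition zero_divisors (A : finComNzRingType) : {set A} :=
  [set x | [exists y : A, (y != 0) && (x * y == 0)]].

Definition total_adj (A : finComNzRingType) : rel A :=
  fun x y => (x != y) && (x + y \in zero_divisors A).

Lemma total_adj_sym (A : finComNzRingType) : symmetric (@total_adj A).
Proof. by move=> x y; rewrite /total_adj eq_sym addrC. Qed.

Lemma total_adj_irr (A : finComNzRingType) : irreflexive (@total_adj A).
Proof. by move=> x; rewrite /total_adj eqxx. Qed.

Definition total_graph (A : finComNzRingType) : sgraph :=
  SGraph (@total_adj_sym A) (@total_adj_irr A).

(* Main.v *)
(** Since 2 is a unit modulo pq, x + x is a zero-divisor iff x is, so a vertex
    has degree |Z| - 1 = p + q - 2 if it lies in the set Z of zero-divisors and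
    |Z| = p + q - 1 otherwise.  Writing the Sombor index as half of a sum over
    ordered pairs of adjacent vertices, it remains to count such pairs inside Z,
    across, and outside Z.  Now Z is the union of the multiples of p and those
    of q, which meet in 0, and x, y in Z have x + y in Z iff both are multiples
    of p or both are multiples of q: this counts the pairs inside Z, and summing
    the degrees over Z and over its complement gives the other two counts. *)

Require Import Defs.
From mathcomp Require Import all_boot all_order all_algebra.
From mathcomp Require Import reals.
From mathcomp Require Import zify ring lra.

Set Implicit Arguments.
Unset Strict Implicit.
Unset Printing Implicit Defensive.

Import Order.TTheory GRing.Theory Num.Theory.
Local Open Scope ring_scope.

(** * Ordered pairs of adjacent vertices *)

Definition darts (G : sgraph) : {set G * G} := [set u | adj u.1 u.2].

(** The fibre of [u |-> [set u.1; u.2]] over an edge with endpoints [a] and [b] consists of [(a, b)]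
    and [(b, a)], which differ because there are no loops. *)
Lemma sum_darts_edges (V : nmodType) (G : sgraph) (F : {set G} -> V) :
  \sum_(u in darts G) F [set u.1; u.2] = (\sum_(e in edges G) F e) *+ 2.
Proof.
rewrite (partition_big (fun u => [set u.1; u.2]) (mem (edges G))) /=;
  last first.
  move=> [x y]; rewrite inE /= => xy.
  by apply/imset2P; exists x y; rewrite ?inE.
rewrite -sumrMnl; apply: eq_bigr => e /imset2P [a b _].
rewrite inE /= => ab ->.
have nab : a != b by apply: contraTneq ab => ->; rewrite adj_irr.
rewrite (bigD1 (a, b)) ?inE ?ab ?eqxx //= (bigD1 (b, a)) /=; last first.
  by rewrite inE /= adj_sym ab setUC eqxx xpair_eqE eq_sym (negPf nab).
rewrite big1 ?addr0 ?mulr2n; first by rewrite [in X in _ + X]setUC.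
(* A third pair in the fibre is impossible: its entries are distinct elements of [[set a; b]]. *)
move=> [x y] /=; rewrite inE /= => /andP [/andP [/andP [xy /eqP E] n1] n2].
have nxy : x != y by apply: contraTneq xy => ->; rewrite adj_irr.
have /set2P xab : x \in [set a; b] by rewrite -E set21.
have /set2P yab : y \in [set a; b] by rewrite -E set22.
by case: xab n1 n2 nxy yab => -> n1 n2 nxy [] yE; move: n1 n2 nxy;
  rewrite yE ?eqxx.
Qed.

Lemma card_darts_from (G : sgraph) (S : {set G}) :
  #|[set u in darts G | u.1 \in S]| = (\sum_(x in S) degree x)%N.
Proof.
rewrite -sum1_card (eq_bigr (fun x => \sum_(y | adj x y) 1)%N); last first.
  by move=> x _; rewrite sum1dep_card.
by rewrite pair_big_dep; apply: eq_bigl => u; rewrite !inE andbC.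
Qed.

Lemma card_darts (G : sgraph) : #|darts G| = #|edges G|.*2.
Proof.
rewrite -!sum1_card (sum_darts_edges (fun=> 1%N)) -muln2.
by rewrite -[LHS]mulr_natr.
Qed.

Definition darts_between (G : sgraph) (S T : {set G}) : {set G * G} :=
  [set u in darts G | (u.1 \in S) && (u.2 \in T)].

Definition ndarts (G : sgraph) (S T : {set G}) : nat := #|darts_between S T|.

Lemma ndartsC (G : sgraph) (S T : {set G}) : ndarts S T = ndarts T S.
Proof.
rewrite /ndarts -(card_imset _ (can_inj (@swap_pairK G G))).
congr #|pred_of_set _|; apply/setP => -[x y].
rewrite -[(x, y)]/(swap_pair (y, x)) mem_imset; last first.
  exact: can_inj (@swap_pairK G G).
by rewrite !inE /= adj_sym [(y \in _) && _]andbC.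
Qed.

Lemma sum_darts_split (V : nmodType) (G : sgraph) (S : {set G})
    (F : G * G -> V) :
  \sum_(u in darts G) F u =
  \sum_(u in darts_between S S) F u + \sum_(u in darts_between S (~: S)) F u
  + (\sum_(u in darts_between (~: S) S) F u
     + \sum_(u in darts_between (~: S) (~: S)) F u).
Proof.
rewrite (bigID (fun u => u.1 \in S)) /=; congr (_ + _);
  rewrite (bigID (fun u => u.2 \in S)) /=; congr (_ + _);
  by apply: eq_bigl => u; rewrite !inE -andbA.
Qed.

Lemma card_darts_split (G : sgraph) (S : {set G}) :
  #|darts G| = (ndarts S S + ndarts S (~: S)
                + (ndarts (~: S) S + ndarts (~: S) (~: S)))%N.
Proof. by rewrite /ndarts -!sum1_card (sum_darts_split S). Qed.

Lemma sum_degree_split (G : sgraph) (S : {set G}) :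
  (\sum_(x in S) degree x)%N
  = (ndarts S S + ndarts S (~: S))%N.
Proof.
rewrite -card_darts_from -(cardsID [set u | u.2 \in S]); congr (_ + _)%N;
  by apply: eq_card => u; rewrite !inE ?[RHS]andbA // andbC -andbA.
Qed.

(** The summand depends only on which side of [S] each endpoint lies. Edges across are met once in
    each direction, whence the [.*2]. *)
Lemma sombor_bidegreed (R : rcfType) (G : sgraph) (S : {set G}) (a b : nat) :
    {in S, forall x, degree x = a} -> {in ~: S, forall x, degree x = b} ->
  sombor R G *+ 2 =
    (Num.sqrt 2 * a%:R) *+ ndarts S S
    + Num.sqrt (a%:R ^+ 2 + b%:R ^+ 2) *+ (ndarts S (~: S)).*2
    + (Num.sqrt 2 * b%:R) *+ ndarts (~: S) (~: S).
Proof.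
move=> Sa Sb.
have sqrtD (c : nat) :
    Num.sqrt (c%:R ^+ 2 + c%:R ^+ 2) = Num.sqrt 2 * c%:R :> R.
  by rewrite -mulr2n -[_ *+ 2]mulr_natl sqrtrM // sqrtr_sqr normr_nat.
have sumE (T1 T2 : {set G}) (c d : nat) : {in T1, forall x : G, degree x = c} ->
    {in T2, forall x : G, degree x = d} ->
    \sum_(u in darts_between T1 T2)
       Num.sqrt (\sum_(x in [set u.1; u.2]) (degree x)%:R ^+ 2)
    = Num.sqrt (c%:R ^+ 2 + d%:R ^+ 2) *+ ndarts T1 T2 :> R.
  move=> T1c T2d; rewrite /ndarts -sumr_const; apply: eq_bigr => -[x y].
  rewrite !inE /= => /andP [xy /andP [xT yT]].
  (* Distinct endpoints make the inner sum have exactly two terms. *)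
  have nxy : x \notin [set y].
    by rewrite inE; apply: contraTneq xy => ->; rewrite adj_irr.
  by rewrite big_setU1 //= big_set1 T1c // T2d.
rewrite /sombor -(sum_darts_edges (fun e : {set G} =>
  Num.sqrt (\sum_(x in e) (degree x)%:R ^+ 2))).
rewrite (sum_darts_split S) (sumE _ _ a a) // (sumE _ _ a b) //.
rewrite (sumE _ _ b a) // (sumE _ _ b b) // !sqrtD.
rewrite [b%:R ^+ 2 + a%:R ^+ 2]addrC (ndartsC (~: S)).
by rewrite -addnn mulrnDr !addrA.
Qed.

(** * Degrees in a total graph *)

(** Translation by [x] is a bijection from [Z] onto the zero-divisors. The neighbours of [x] are the
    elements of [Z] other than [x], and [x] lies in [Z] iff [x + x] is a zero-divisor, that is, iff
    [x] is. *)
Lemma degree_total_graph (A : finComNzRingType) (x : total_graph A) :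
  (2 : A) \notin zero_divisors A ->
  (degree x + (x \in zero_divisors A))%N = #|zero_divisors A|.
Proof.
move=> n2; pose Z := [set y : A | x + y \in zero_divisors A].
have <- : #|Z| = #|zero_divisors A|.
  rewrite -(card_imset _ (addrI x)); apply: eq_card => z.
  by rewrite -[z](subrKC x) mem_imset ?inE //; exact: addrI.
rewrite [RHS](cardsD1 x) addnC; congr (_ + _)%N.
  congr nat_of_bool; rewrite !inE; apply: eq_existsb => y.
  case: eqP => //= /eqP y0; apply/eqP/eqP => [xy|xy2].
    by rewrite mulrDl xy addr0.
  (* If [y] kills [x + x] but not [x], then [x * y] is a nonzero element killed by 2. *)
  apply: contraNeq n2 => xy; rewrite inE; apply/existsP; exists (x * y).
  by rewrite xy mulrA mulr_natl mulr2n xy2 eqxx.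
by apply: eq_card => y; rewrite !inE /= /total_adj inE eq_sym.
Qed.

Lemma card_offdiagonal (T : finType) (A : {set T}) :
  #|[set u in setX A A | u.1 != u.2]| = (#|A| * #|A|.-1)%N.
Proof.
rewrite -sum1_card -sum_nat_const.
rewrite (eq_bigr (fun x => \sum_(y in A :\ x) 1)%N); last first.
  by move=> x xA; rewrite sum1_card (cardsD1 x A) xA.
rewrite pair_big_dep; apply: eq_bigl => -[x y].
by rewrite !inE /= eq_sym -andbA [(y \in A) && _]andbC.
Qed.

(** * Multiples of a divisor of the modulus *)

Definition multiples (n d : nat) : {set 'Z_n} := [set x : 'Z_n | (d %| x)%N].

Lemma dvdn_Zp_add n d (x y : 'Z_n) :
  (1 < n)%N -> (d %| n)%N -> (d %| (x + y)%R)%N = (d %| x + y)%N.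
Proof. by move=> n1 dn; rewrite /dvdn /= modn_dvdm ?Zp_cast. Qed.

Lemma Zp_eq0 n (x : 'Z_n) : (1 < n)%N -> (x == 0) = (n %| x)%N.
Proof.
move=> n1; rewrite /dvdn modn_small //.
by rewrite -[X in (_ < X)%N](Zp_cast n1).
Qed.

Lemma card_multiples n d :
  (1 < n)%N -> (d %| n)%N -> #|multiples n d| = (n %/ d)%N.
Proof.
move=> n1 dn; rewrite divn_count_dvd -sum1_card.
rewrite (eq_bigl (fun x : 'Z_n => (d %| x)%N)); last by move=> x; rewrite !inE.
rewrite -(big_mkord (fun i => d %| i)%N (fun=> 1%N)) Zp_cast // big_mkcond /=.
(* The residues run from 0 to [n - 1], whereas the quotient counts multiples from 1 to [n]; both 0
   and [n] are multiples of [d], so trading one for the other keeps the count. *)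
rewrite big_ltn ?(ltnW n1) // big_nat_recr ?(ltnW n1) //= dvdn0 dn addnC.
by congr (_ + _)%N; apply: eq_bigr => i _; case: (_ %| _)%N.
Qed.

(** * Zero-divisors modulo a product of two distinct primes *)

Section TwoPrimes.

Variables p q : nat.
Hypotheses (p_prime : prime p) (q_prime : prime q) (pq : p != q).

Let pq_gt1 : (1 < p * q)%N.
Proof. by have := prime_gt1 p_prime; have := prime_gt1 q_prime; nia. Qed.

Let co_pq : coprime p q.
Proof. by rewrite prime_coprime // dvdn_prime2. Qed.

Let p_dvd : (p %| p * q)%N. Proof. exact: dvdn_mulr. Qed.
Let q_dvd : (q %| p * q)%N. Proof. exact: dvdn_mull. Qed.

(** An [x] divisible by neither prime is coprime to [p * q], hence a unit. A multiple of one prime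
    is killed by the other prime, which is nonzero modulo [p * q]. *)
Lemma zero_divisors_Zpq :
  zero_divisors 'Z_(p * q) = multiples (p * q) p :|: multiples (p * q) q.
Proof.
have dvd0 (x y : 'Z_(p * q)) : (p * q %| x * y)%N -> x * y = 0.
  by move=> d; apply/eqP; rewrite Zp_eq0 // /dvdn /= modn_dvdm ?Zp_cast.
have nat0 r : (0 < r < p * q)%N -> r%:R != 0 :> 'Z_(p * q).
  move=> /andP [r0 rn]; apply/negP => /eqP /(congr1 val) /=.
  by rewrite val_Zp_nat // modn_small // => r0'; rewrite r0' in r0.
have p1 := prime_gt1 p_prime; have q1 := prime_gt1 q_prime.
apply/setP => x; rewrite !inE; apply/existsP/idP.
  move=> [y /andP [y0 /eqP xy]]; apply: contraNT y0.
  rewrite negb_or -!prime_coprime // => /andP [px qx].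
  have ux : x \is a GRing.unit.
    by rewrite -[x]natr_Zp unitZpE // coprimeMl px.
  by rewrite -[y](mulKr ux) xy mulr0.
case/orP => dx; [exists q%:R | exists p%:R];
  rewrite nat0 /=; try nia; apply/eqP/dvd0; rewrite val_Zp_nat // modn_small;
  try nia.
  exact: dvdn_mul.
by rewrite [X in (_ %| X)%N]mulnC; exact: dvdn_mul.
Qed.

Lemma multiplesI_Zpq :
  multiples (p * q) p :&: multiples (p * q) q = [set 0].
Proof.
by apply/setP => x; rewrite !inE -Gauss_dvd // Zp_eq0.
Qed.

Lemma card_zero_divisors_Zpq : #|zero_divisors 'Z_(p * q)|.+1 = (p + q)%N.
Proof.
have p0 := prime_gt0 p_prime; have q0 := prime_gt0 q_prime.
rewrite zero_divisors_Zpq -addn1 -[in LHS](cards1 (0 : 'Z_(p * q))).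
rewrite -multiplesI_Zpq cardsUI !card_multiples ?p_dvd ?q_dvd //.
by rewrite mulnK // mulKn // addnC.
Qed.

(** The pairs split into [off p] and [off q], made of distinct multiples of [p] and of [q]. These
    are disjoint, since only [(0, 0)] could be common and it is off limits. There are [q] multiples
    of [p] and [p] multiples of [q]. *)
Lemma ndarts_zero_divisors_Zpq :
  @ndarts (total_graph 'Z_(p * q)) (zero_divisors 'Z_(p * q))
          (zero_divisors 'Z_(p * q)) = (p * p.-1 + q * q.-1)%N.
Proof.
rewrite /ndarts; set Z := zero_divisors _.
have p0 := prime_gt0 p_prime; have q0 := prime_gt0 q_prime.
pose off d := [set u in setX (multiples (p * q) d) (multiples (p * q) d)
               | u.1 != u.2].
have cardoff d : (d %| p * q)%N ->
    #|off d| = ((p * q %/ d) * (p * q %/ d).-1)%N.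
  by move=> d_dvd; rewrite card_offdiagonal card_multiples.
have ZE (z : 'Z_(p * q)) : (z \in Z) = (p %| z)%N || (q %| z)%N.
  by rewrite /Z zero_divisors_Zpq !inE.
have -> : @darts_between (total_graph 'Z_(p * q)) Z Z = off p :|: off q.
  apply/setP => -[x y]; rewrite in_set [_ \in darts _]in_set /= /total_adj.
  rewrite -/Z !ZE !inE /=.
  case: eqVneq => _; rewrite ?andbF //= !andbT.
  rewrite !dvdn_Zp_add ?p_dvd ?q_dvd //.
  (* If a prime divides both [x] and [y], it divides the sum. Otherwise one is divisible by [p] only
     and the other by [q] only, and neither prime divides the sum. *)
  case px: (p %| x)%N; case qx: (q %| x)%N; case py: (p %| y)%N;
  case qy: (q %| y)%N; rewrite ?andbF ?orbF //=;
  rewrite ?(dvdn_addr _ px) ?(dvdn_addr _ qx) ?(dvdn_addl _ py);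
  by rewrite ?(dvdn_addl _ qy) ?px ?py ?qx ?qy ?orbT.
have disj : off p :&: off q = set0.
  apply/setP => -[x y]; rewrite !inE /=; apply/negP.
  move=> /andP [/andP [/andP [px py] xy] /andP [/andP [qx qy] _]].
  have zero (z : 'Z_(p * q)) : (p %| val z)%N -> (q %| val z)%N -> z = 0.
    by move=> pz qz; apply/set1P; rewrite -multiplesI_Zpq !inE pz.
  by move: xy; rewrite (zero x) // (zero y) // eqxx.
rewrite cardsU disj cards0 subn0 !cardoff ?p_dvd ?q_dvd //.
by rewrite mulnK // mulKn // addnC.
Qed.

End TwoPrimes.

(** * Assembling the formula for odd primes *)

Lemma two_notin_zero_divisors_Zn n :
  (1 < n)%N -> odd n -> (2 : 'Z_n) \notin zero_divisors 'Z_n.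
Proof.
move=> n1 on; rewrite inE; apply/existsP => -[y /andP [y0 /eqP y2]].
have u2 : (2 : 'Z_n) \is a GRing.unit by rewrite unitZpE // coprimen2.
by case/eqP: y0; rewrite -[y](mulKr u2) y2 mulr0.
Qed.

Theorem theorem3p2 (R : realType) (p q : nat)
    (p_prime : prime p) (q_prime : prime q)
    (p_odd : odd p) (q_odd : odd q) (ltpq : (p < q)%N) :
  let G := total_graph 'Z_(p * q) in
  let P : R := p%:R in
  let Q : R := q%:R in
  let phi : R := (totient (p * q))%:R in
  let alpha : R := (P * (P - 1) + Q * (Q - 1)) / 2 in
  let beta : R := 2 * (P - 1) * (Q - 1) in
  let E : R := #|edges G|%:R in
  E = (P * Q - 1) * (P + Q - 1) / 2 /\
  sombor R G =
    Num.sqrt 2 * alpha * (P * Q - phi - 1)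
    + beta * Num.sqrt ((P * Q - phi - 1) ^+ 2 + (P * Q - phi) ^+ 2)
    + Num.sqrt 2 * (E - alpha - beta) * (P * Q - phi).
Proof.
move=> G P Q phi alpha beta E.
have npq : p != q by rewrite neq_ltn ltpq.
have p1 := prime_gt1 p_prime; have q1 := prime_gt1 q_prime.
have pq1 : (1 < p * q)%N by nia.
have leZ : ((p + q).-1 <= p * q)%N by nia.
pose Z : {set G} := zero_divisors 'Z_(p * q).
have cZ : #|Z| = (p + q).-1.
  by rewrite -(card_zero_divisors_Zpq p_prime q_prime npq).
have cG : #|G| = (p * q)%N by rewrite card_ord Zp_cast.
have deg (x : G) : (degree x + (x \in Z))%N = (p + q).-1.
  rewrite degree_total_graph //.
  by apply: two_notin_zero_divisors_Zn; rewrite // oddM p_odd.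
have degZ : {in Z, forall x, degree x = (p + q).-2}.
  by move=> x xZ; rewrite -(deg x) xZ addn1.
have degC : {in ~: Z, forall x, degree x = (p + q).-1}.
  by move=> x; rewrite inE => /negPf xZ; rewrite -(deg x) xZ addn0.
have cC : #|~: Z| = (p * q - (p + q).-1)%N by rewrite cardsCs setCK cG cZ.
have := ndarts_zero_divisors_Zpq p_prime q_prime npq.
rewrite -/G -/Z => n11.
have := sum_degree_split Z.
rewrite (eq_bigr (fun=> (p + q).-2)) // sum_nat_const cZ n11 => n10.
have := sum_degree_split (~: Z); rewrite setCK.
rewrite (eq_bigr (fun=> (p + q).-1)) // sum_nat_const cC => n0.
have := card_darts_split Z; rewrite card_darts n11 => nE.
have n01 := ndartsC (~: Z) Z.
have S2 := sombor_bidegreed R degZ degC.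
have natr_pred m : (0 < m)%N -> m.-1%:R = m%:R - 1 :> R.
  by move=> m0; rewrite -subn1 natrB.
have aE : (p + q).-2%:R = P + Q - 2 :> R.
  by rewrite -subn2 natrB ?natrD //; lia.
have bE : (p + q).-1%:R = P + Q - 1 :> R by rewrite natr_pred ?natrD //; lia.
have phiE : phi = (P - 1) * (Q - 1).
  rewrite /phi totient_coprime ?prime_coprime ?dvdn_prime2 //.
  by rewrite !totient_prime // natrM !natr_pred // ltnW.
have n11E : (ndarts Z Z)%:R = P * (P - 1) + Q * (Q - 1) :> R.
  by rewrite n11 natrD !natrM !natr_pred // ltnW.
(* The degree sum over [Z] is [(p + q - 1) * (p + q - 2)]; removing the pairs inside [Z] leaves
   those that cross. *)
have n10E : (ndarts Z (~: Z))%:R = beta.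
  have -> : beta = (P + Q - 1) * (P + Q - 2) - (ndarts Z Z)%:R.
    by rewrite n11E /beta; ring.
  by rewrite -aE -bE -natrM n10 -n11 natrD addrC addKr.
have n00E : (ndarts (~: Z) (~: Z))%:R = (P - 1) * (Q - 1) * (P + Q - 1) - beta.
  (* The complement of [Z] has [p * q - (p + q - 1) = (p - 1) * (q - 1)] elements. *)
  have -> : (P - 1) * (Q - 1) = (p * q - (p + q).-1)%:R.
    by rewrite natrB // natrM bE; ring.
  by rewrite -bE -natrM n0 n01 natrD n10E addrK.
have EE : E = (P * Q - 1) * (P + Q - 1) / 2.
  have : E * 2 = (P * Q - 1) * (P + Q - 1).
    rewrite -natrM muln2 nE n01 -n11 !natrD n11E n10E n00E /beta; ring.
  lra.
split=> //.
have -> : sombor R G = sombor R G *+ 2 / 2.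
  by rewrite -[sombor R G *+ 2]mulr_natr mulfK // pnatr_eq0.
rewrite S2 -[_ *+ ndarts Z Z]mulr_natr -[_ *+ _.*2]mulr_natr.
rewrite -[_ *+ ndarts (~: Z) _]mulr_natr -muln2 natrM n11E n10E n00E aE bE EE.
(* This is the degree outside [Z], and one less is the degree inside; [alpha] and [beta] count the
   edges inside [Z] and across. *)
have -> : P * Q - phi = P + Q - 1 by rewrite phiE; ring.
have -> : P + Q - 1 - 1 = P + Q - 2 by ring.
by rewrite /alpha /beta; field.
Qed.
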